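(* Let $f:\mathbb{R}^n\to\mathbb{R}$ be convex and differentiable, $A\in\mathbb{R}^{m\times n}$, $b\in\mathbb{R}^m$, $t_0>0$. Assume that $\alpha>1$, that $\beta:[t_0,+\infty)\to(0,+\infty)$ is a continuously differentiable function satisfying $$t\dot\beta(t)\le(\alpha-3)\beta(t)\ \text{ for all } t\ge t_0,\qquad \lim_{t\to+\infty}t^2\beta(t)=+\infty,$$ and that $\epsilon:[t_0,+\infty)\to\mathbb{R}^n$ is an integrable function satisfying $$\int_{t_0}^{+\infty}t\|\epsilon(t)\|\,dt<+\infty.$$ Let $(x(t),\lambda(t))$ be a global solution on $[t_0,+\infty)$ of the dynamical system $$\begin{cases}\ddot x(t)+\frac{\alpha}{t}\dot x(t)=-\beta(t)\big(\nabla f(x(t))+A^T\lambda(t)\big)+\epsilon(t),\\[2pt] \dot\lambda(t)=t\beta(t)\Big(A\big(x(t)+\frac{t}{\alpha-1}\dot x(t)\big)-b\Big),\end{cases}$$ and let $(x^*,\lambda^* )\in\Omega$, the set of KKT points of the problem $\min_x f(x)$ s.t. $Ax=b$. Then, as $t\to+\infty$, $$\|Ax(t)-b\|=\mathcal{O}\left(\frac{1}{t^2\beta(t)}\right),\qquad |f(x(t))-f(x^* )|=\mathcal{O}\left(\frac{1}{t^2\beta(t)}\right).$$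
   Context: $\|\cdot\|$ is the Euclidean norm. The KKT set $\Omega$ consists of all $(x^*,\lambda^* )\in\mathbb{R}^n\times\mathbb{R}^m$ with $-A^T\lambda^*=\nabla f(x^* )$ and $Ax^*=b$ (assumed nonempty). A global solution is a pair $x:[t_0,+\infty)\to\mathbb{R}^n$, $\lambda:[t_0,+\infty)\to\mathbb{R}^m$ with $x$ and $\lambda$ continuously differentiable, $\dot x$ locally absolutely continuous, the first equation holding for almost every $t\ge t_0$ and the second for every $t\ge t_0$ (for instance a $C^2$ function $x$ and a $C^1$ function $\lambda$ satisfying both equations everywhere). *)

(* Defs.v *)
From HB Require Import structures.
From mathcomp Require Import all_boot all_order all_algebra.
From mathcomp Require Import all_classical all_reals all_analysis.
Set Implicit Arguments.
Unset Strict Implicit.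
Unset Printing Implicit Defensive.
Import Order.TTheory GRing.Theory Num.Theory.
Import numFieldNormedType.Exports.
Local Open Scope classical_set_scope.
Local Open Scope ring_scope.

(* Makes the Landau notation f =O_+oo g usable. *)
Canonical pinfty_filter_on (R : realType) : filter_on R :=
  FilterType (pinfty_nbhs R) _.

(* The library norm `|u| on matrices is the sup norm. *)
Definition enorm {R : realType} {n : nat} (u : 'cV[R]_n) : R :=
  Num.sqrt (\sum_(i < n) u i 0 ^+ 2).

Definition grad {R : realType} {n : nat} (f : 'cV[R]_n -> R) (z : 'cV[R]_n) :
    'cV[R]_n :=
  \col_i 'D_(delta_mx i 0) f z.

(* A function on [t0, +oo[ is encoded as a total function on R whose values
   outside [t0, +oo[ are never used: the increments h are restricted to
   t0 <= t + h, so that the derivative at t0 is the right derivative and the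
   derivative at t > t0 is the usual one. *)
Section from.
Context {R : realType} {V : normedModType R}.

Definition derivable_from (t0 : R) (g : R -> V) (t : R) : Prop :=
  cvg ((fun h => h^-1 *: (g (t + h) - g t))
         @ within [set h | t0 <= t + h] (0 : R)^').

Definition derive_from (t0 : R) (g : R -> V) (t : R) : V :=
  lim ((fun h => h^-1 *: (g (t + h) - g t))
         @ within [set h | t0 <= t + h] (0 : R)^').

Definition C1_from (t0 : R) (g : R -> V) : Prop :=
  (forall t, t0 <= t -> derivable_from t0 g t) /\
  {within `[t0, +oo[, continuous (derive_from t0 g)}.

End from.

Definition abs_continuous {R : realType} {n : nat} (a b : R)
    (g : R -> 'cV[R]_n) : Prop :=
  forall e : R, 0 < e -> exists2 d : R, 0 < d &
    forall (N : nat) (u v : 'I_N -> R),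
      (forall i, [/\ a <= u i, u i <= v i & v i <= b]) ->
      trivIset [set: 'I_N] (fun i => `]u i, v i[%classic) ->
      \sum_(i < N) (v i - u i) < d ->
      \sum_(i < N) enorm (g (v i) - g (u i)) < e.

Definition loc_abs_continuous_from {R : realType} {n : nat} (t0 : R)
    (g : R -> 'cV[R]_n) : Prop :=
  forall a b : R, t0 <= a -> a <= b -> abs_continuous a b g.

Section dynamics.
Context {R : realType} {n m : nat}.
Variables (f : 'cV[R]_n -> R) (A : 'M[R]_(m, n)) (b : 'cV[R]_m).

Definition KKT_set : set ('cV[R]_n * 'cV[R]_m) :=
  [set p | - (A^T *m p.2) = grad f p.1 /\ A *m p.1 = b].

Definition global_solution (t0 alpha : R) (beta : R -> R) (eps : R -> 'cV[R]_n)
    (x : R -> 'cV[R]_n) (lam : R -> 'cV[R]_m) : Prop :=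
  let dx := derive_from t0 x in
  [/\ C1_from t0 x,
      C1_from t0 lam,
      loc_abs_continuous_from t0 dx,
      {ae lebesgue_measure, forall t, t0 <= t ->
        derivable_from t0 dx t /\
        derive_from t0 dx t + (alpha / t) *: dx t =
          - beta t *: (grad f (x t) + A^T *m lam t) + eps t} &
      forall t, t0 <= t ->
        derive_from t0 lam t =
          (t * beta t) *: (A *m (x t + (t / (alpha - 1)) *: dx t) - b)].

End dynamics.

(* Main.v *)
Require Import Defs.
From HB Require Import structures.
From mathcomp Require Import all_boot all_order all_algebra.
From mathcomp Require Import all_classical all_reals all_analysis.
From mathcomp Require Import measurable_realfun ring lra.
Import Order.TTheory GRing.Theory Num.Theory.
Import numFieldNormedType.Exports.
Local Open Scope classical_set_scope.
Local Open Scope ring_scope.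

(* With c = 1/(alpha-1), v = x - xs + c t x' and D = f(x) - f(xs) + <lams, Ax - b>
   (nonnegative by convexity and the KKT conditions), the energy
   E = c^2 t^2 beta D + |v|^2/2 + (c/2) |lam - lams|^2
   satisfies E' <= c t |eps| (1 + E) almost everywhere. It is absolutely
   continuous on compact intervals, so ln (1 + E) grows by at most
   c \int t |eps|, and E is bounded: D = O(1/(t^2 beta)) and lam is bounded.
   For r = Ax - b and the nondecreasing weight mu = t^(alpha-3)/beta, the
   multiplier equation reads (t^(alpha-1) r)' = (alpha-1) mu lam'; integrating by
   parts against the bounded lam gives t^(alpha-1) |r| = O(mu), which is the
   feasibility rate, and the rate for f(x) - f(xs) = D - <lams, r> follows. *)

(** The first equation, and the derivative of a primitive of t |eps|, are available only almost
    everywhere, so the differential inequality for E cannot be integrated by the mean value theorem.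
    E is compared instead with a primitive [G] of t |eps|, of which only monotonicity, boundedness
    and the derivative off a null set are kept. This asymmetric comparison, with absolute continuity
    asked of the smaller side only, is a covering argument run by induction along [a, b]. The
    forcing enters E' as c t <v, eps>, which is linear in |v|; replacing |v| by (1 + |v|^2)/2 <= 1 +
    E gives E' <= g (1 + E), which the logarithm integrates without any square root of E. The
    feasibility estimate needs only the multiplier equation, the growth condition on beta and a
    bound on lam, so it is a scalar statement applied to each coordinate of r. All estimates start
    at a point beyond t0, where the one-sided derivatives are two-sided. *)

(** * Induction along an interval and first-order approximation *)

(** Let s be the supremum of the points where [P] holds. The local step at s carries [P] from a
    point just left of s to one beyond s, which is absurd unless s = b. The form u <= c <= v is that
    of a fine tagged partition with tag c, so gauge-type arguments run without building the
    partition. *)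
Lemma cousin_induction (R : realType) (P : R -> Prop) (a b : R) : a <= b -> P a ->
  (forall c, a <= c <= b -> exists2 d, 0 < d &
    forall u v, a <= u -> u <= c -> c <= v -> v <= b -> c - d < u -> v < c + d ->
      P u -> P v) ->
  P b.
Proof.
move=> ab Pa loc.
pose S := [set t | a <= t <= b /\ P t].
have Sa : S a by split => //; rewrite lexx.
have hS : has_sup S.
  by split; [exists a | exists b => t -[/andP[]]].
have ac : a <= sup S by apply: ub_le_sup => //; exact: hS.2.
have cb : sup S <= b by apply: ge_sup; [exists a | move=> t [/andP[]]].
have [|d d0 dP] := loc (sup S); first by rewrite ac.
have [u [/andP[au ub] Pu] du] := sup_adherent d0 hS.
have us : u <= sup S by apply: ub_le_sup; [exact: hS.2 | split=> //; rewrite au].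
pose v := Order.min b (sup S + d / 2).
have vb : v <= b by rewrite /v ge_min lexx.
have sv : sup S <= v by rewrite /v le_min cb /=; lra.
have Pv : P v.
  by apply: (dP u v) => //; rewrite /v gt_min; apply/orP; right; lra.
have : v <= sup S.
  apply: ub_le_sup; first exact: hS.2.
  by split=> //; rewrite vb andbT (le_trans ac).
rewrite /v ge_min => /orP[bs|]; last by move=> ?; exfalso; lra.
by move: Pv; rewrite /v min_l //; lra.
Qed.

Lemma is_derive_approx (R : realType) (F : R -> R) (t dF : R) :
  is_derive t 1 F dF -> forall e, 0 < e -> exists2 r, 0 < r &
    forall u, `|u - t| < r -> `|F u - F t - dF * (u - t)| <= e * `|u - t|.
Proof.
move=> [/= dr <-] e e0.
have /cvgrPdist_le/(_ e e0)/nbhs_ballP[r /= r0 rP] := dr.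
exists r => // u tu.
have [->|ut] := eqVneq u t; first by rewrite !subrr mulr0 normr0 mulr0 subrr normr0.
have ut0 : u - t != 0 by rewrite subr_eq0.
have := rP (u - t); rewrite /ball /= sub0r normrN => /(_ tu ut0).
rewrite /GRing.scale /= mulr1 subrK => H.
have -> : F u - F t - 'D_1 F t * (u - t) =
  - (('D_1 F t - (u - t)^-1 * (F u - F t)) * (u - t)) by field.
by rewrite normrN normrM ler_wpM2r.
Qed.

(** * Absolute continuity and comparison of derivatives off a null set *)

Section chains.
Context {R : realType}.
Implicit Types (a b : R) (s : seq (R * R)).

(* A chain in [a, b] lists non-overlapping intervals from right to left. *)
Fixpoint chain a b s : Prop :=
  if s is p :: s' then [/\ p.1 <= p.2, p.2 <= b & chain a p.1 s'] else a <= b.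

Lemma chain_le a b s : chain a b s -> a <= b.
Proof.
elim: s b => //= p s IH b [p12 pb /IH]; lra.
Qed.

Lemma chain_widen a b c s : b <= c -> chain a b s -> chain a c s.
Proof.
case: s => [|p s] bc /=; first by move/le_trans; exact.
by case=> ? pb ?; split=> //; exact: le_trans bc.
Qed.

Lemma chain_mem a b s p : chain a b s -> p \in s ->
  [/\ a <= p.1, p.1 <= p.2 & p.2 <= b].
Proof.
elim: s b => //= q s IH b [q12 qb cs]; rewrite inE => /predU1P[->|].
  by rewrite (chain_le _ _ _ cs).
by move=> /(IH _ cs)[? ? ?]; split=> //; lra.
Qed.

Lemma chain_nth_lt a b s i j : chain a b s -> (i < j)%N -> (j < size s)%N ->
  (nth (0, 0) s j).2 <= (nth (0, 0) s i).1.
Proof.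
elim: s b i j => //= p s IH b [|i] [|j] //= [p12 pb cs].
  by move=> _ js; have [] := chain_mem _ _ _ _ cs (mem_nth (0, 0) js).
by rewrite !ltnS; exact: IH cs.
Qed.

(** Lists instead of indexed families: an induction moving to the right adds an interval by a single
    cons. *)
Definition ac a b (F : R -> R) : Prop :=
  forall e, 0 < e -> exists2 d, 0 < d & forall s, chain a b s ->
    \sum_(p <- s) (p.2 - p.1) < d -> \sum_(p <- s) `|F p.2 - F p.1| < e.

(** Common source of the closure properties: Lipschitz functions, sums, products and logarithms all
    have increments dominated in this way. Two controlling functions are what a product requires. *)
Lemma ac_comp_le a b (F G H : R -> R) (K : R) :
  ac a b G -> ac a b H ->
  (forall u v, a <= u -> u <= v -> v <= b ->
    `|F v - F u| <= K * (`|G v - G u| + `|H v - H u|)) ->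
  ac a b F.
Proof.
move=> aG aH FGH e e0.
(* A positive majorant of [K], whose sign is arbitrary, so that dividing by it is legitimate. *)
pose M := 1 + `|K|.
have M0 : 0 < M by rewrite /M; have := normr_ge0 K; lra.
have KM : K <= M by rewrite /M; have := ler_norm K; lra.
have eM : 0 < e / (2 * M) by rewrite divr_gt0 // mulr_gt0.
have [d1 d10 G1] := aG _ eM; have [d2 d20 H2] := aH _ eM.
exists (Order.min d1 d2) => [|s cs]; first by rewrite lt_min d10.
rewrite lt_min => /andP[s1 s2].
have {}G1 := G1 _ cs s1; have {}H2 := H2 _ cs s2.
apply: (@le_lt_trans _ _ (M * (\sum_(p <- s) `|G p.2 - G p.1| + \sum_(p <- s) `|H p.2 - H p.1|))).
  rewrite -big_split /= mulr_sumr big_seq [leRHS]big_seq.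
  apply: ler_sum => p /(chain_mem _ _ _ _ cs)[p1 p12 p2].
  apply: le_trans (FGH _ _ p1 p12 p2) _.
  by apply: ler_wpM2r => //; apply: addr_ge0.
have -> : e = M * (e / (2 * M) + e / (2 * M)) by field; lra.
by rewrite ltr_pM2l // ltrD.
Qed.

Lemma ac_id a b : ac a b id.
Proof.
move=> e e0; exists e => // s cs; congr (_ < _).
rewrite big_seq [RHS]big_seq; apply: eq_bigr => p /(chain_mem _ _ _ _ cs)[_ p12 _].
by rewrite ger0_norm // subr_ge0.
Qed.

Definition bnd a b (F : R -> R) : Prop := exists M : R, forall t, a <= t -> t <= b -> `|F t| <= M.

(** The bound travels with absolute continuity because the increment of a product involves the
    values of its factors. *)
Definition ac_bnd a b F := ac a b F /\ bnd a b F.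

Lemma ac_bnd_lip a b F K : (forall u v, a <= u -> u <= v -> v <= b ->
  `|F v - F u| <= K * (v - u)) -> ac_bnd a b F.
Proof.
move=> FK; split.
  apply: (@ac_comp_le a b F id id K); try exact: ac_id.
  move=> u v au uv vb; apply: le_trans (FK _ _ au uv vb) _.
  have := FK _ _ au uv vb; have := normr_ge0 (F v - F u).
  by rewrite /= (ger0_norm (_ : 0 <= v - u)) ?subr_ge0 //; lra.
exists (`|F a| + `|K| * (b - a)) => t at_ tb.
have := FK _ _ (lexx a) at_ tb.
have : K * (t - a) <= `|K| * (b - a).
  apply: (@le_trans _ _ (`|K| * (t - a))).
    by rewrite ler_wpM2r ?ler_norm // subr_ge0.
  by rewrite ler_wpM2l // lerB.
have : `|F t| <= `|F t - F a| + `|F a| by rewrite -{1}(subrK (F a) (F t)) ler_normD.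
lra.
Qed.

Lemma ac_bnd_cst a b k : ac_bnd a b (fun=> k).
Proof. by apply: (@ac_bnd_lip _ _ _ 0) => u v *; rewrite subrr normr0 mul0r. Qed.

Lemma ac_bnd_id a b : ac_bnd a b id.
Proof.
by apply: (@ac_bnd_lip _ _ _ 1) => u v _ uv _; rewrite mul1r ger0_norm // subr_ge0.
Qed.

Lemma ac_bndD a b F G : ac_bnd a b F -> ac_bnd a b G -> ac_bnd a b (fun t => F t + G t).
Proof.
move=> [aF [M FM]] [aG [N GN]]; split.
  apply: (@ac_comp_le a b _ F G 1) => // u v _ _ _.
  by rewrite mul1r opprD addrACA ler_normD.
exists (M + N) => t at_ tb; apply: le_trans (ler_normD _ _) _.
by rewrite lerD ?FM ?GN.
Qed.

Lemma ac_bndM a b F G : ac_bnd a b F -> ac_bnd a b G -> ac_bnd a b (fun t => F t * G t).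
Proof.
move=> [aF [M FM]] [aG [N GN]]; split; last first.
  exists (M * N) => t at_ tb.
  by rewrite normrM ler_pM ?FM ?GN.
apply: (@ac_comp_le a b _ F G (`|M| + `|N|)) => // u v au uv vb.
have -> : F v * G v - F u * G u = (F v - F u) * G v + F u * (G v - G u) by ring.
apply: le_trans (ler_normD _ _) _; rewrite !normrM.
have := FM _ au (le_trans uv vb); have := GN _ (le_trans au uv) vb.
have := ler_norm M; have := ler_norm N.
have := normr_ge0 M; have := normr_ge0 N.
have := normr_ge0 (F u); have := normr_ge0 (G v).
have := normr_ge0 (F v - F u); have := normr_ge0 (G v - G u).
nra.
Qed.

Lemma ac_bnd_sum a b n (F : 'I_n -> R -> R) : (forall i, ac_bnd a b (F i)) ->
  ac_bnd a b (fun t => \sum_(i < n) F i t).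
Proof.
move=> FA; elim: n F FA => [|n IH] F FA.
  by under eq_fun do rewrite big_ord0; exact: ac_bnd_cst.
under eq_fun do rewrite big_ord_recl.
by apply: ac_bndD => //; exact: IH.
Qed.

Local Notation mu := (@lebesgue_measure R).

(* Cover N by an open set of small measure. Intervals tagged in N are absorbed by
   the absolute continuity of F and the monotonicity of G, the others by the
   derivatives at the tag; G itself need not be absolutely continuous. *)
Lemma ac_derive_le a b (F G : R -> R) (N : set R) : a <= b -> ac a b F ->
  {homo G : u v / u <= v} -> mu.-negligible N ->
  (forall t, a <= t -> t <= b -> ~ N t ->
    exists dF dG : R, [/\ is_derive t (1 : R) F dF, is_derive t (1 : R) G dG & dF <= dG]) ->
  F b - F a <= G b - G a.
Proof.
move=> ab aF Gh [B [mB B0 NB]] FG.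
apply/ler_addgt0Pr => e0 e00.
(* The error is [e] per unit length on good intervals, plus a single [e] for all the intervals
   tagged in [N]. *)
pose e := e0 / (b - a + 1).
have e_gt0 : 0 < e by rewrite divr_gt0 //; lra.
have -> : e0 = e * (b - a) + e by rewrite /e; field; lra.
have [d d0 Fd] := aF _ e_gt0.
have d2 : 0 < d / 2 by lra.
have [U [oU BO Od]] := @outer_measure_open_le R B _ d2.
have {}Od : (mu U < d%:E)%E.
  apply: le_lt_trans Od _.
  rewrite (_ : (wlength idfun)^*%mu B = mu B) // B0 add0e lte_fin; lra.
have mule (A C : set (measurableTypeR R)) : measurable A -> measurable C ->
    A `<=` C -> (mu A <= mu C)%E.
  by move=> mA mC AC; apply: le_measure; rewrite ?inE.
have mO : measurable (U : set (measurableTypeR R)).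
  exact: open_measurable.
pose m t := fine (mu (U `&` `]a, t])).
have mOt t : measurable (U `&` `]a, t] : set (measurableTypeR R)).
  by apply: measurableI => //; exact: measurable_itv.
have mfin t : (mu (U `&` `]a, t]) < d%:E)%E.
  by apply: le_lt_trans Od; apply: mule => //; exact: subIsetl.
have mE t : mu (U `&` `]a, t]) = (m t)%:E.
  by rewrite fineK // ge0_fin_numE // (lt_trans (mfin t)) // ltry.
have m_le u v : u <= v -> m u <= m v.
  move=> uv; rewrite -lee_fin -!mE; apply: mule => //.
  by apply: setIS; apply: subset_itvl; rewrite bnd_simp.
have m_add u v : a <= u -> u <= v -> `[u, v] `<=` U -> m u + (v - u) <= m v.
  move=> au uv uvO; rewrite -lee_fin EFinD -!mE.
  have -> : ((v - u)%:E = mu `]u, v])%E.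
    by rewrite lebesgue_measure_itv /= lte_fin; case: ltgtP uv => // -> _; rewrite subrr.
  rewrite -measureU //; last first.
    by rewrite -subset0 => x /= [[_]]; rewrite !in_itv /= => ? ?; lra.
  apply: mule => //; first by apply: measurableU => //; exact: measurable_itv.
  move=> x /= [[Ox]|xuv].
    by rewrite !in_itv /= => /andP[-> /le_trans ->].
  split; first by apply: uvO; move: xuv; rewrite /= !in_itv /= => /andP[/ltW-> ->].
  by move: xuv; rewrite /= !in_itv /= => /andP[? ->]; rewrite andbT; lra.
(* The chain [s] records the intervals crossed at tags in [N]. They lie in [U], so their total
   length is paid for by [m t], which stays below [d]; at [b] the absolute continuity of [F] then
   bounds the last sum by [e]. *)
pose P t := exists s, [/\ chain a t s, \sum_(p <- s) (p.2 - p.1) <= m t &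
  F t - F a <= G t - G a + e * (t - a) + \sum_(p <- s) `|F p.2 - F p.1|].
have [s [cs sm Fb]] : P b.
  apply: (@cousin_induction R P a b ab).
    by exists [::]; split; rewrite ?big_nil //= ?/m ?fine_ge0 //; lra.
  move=> c /andP[ac_ cb].
  have [Nc|Nc] := pselect (N c).
    have /nbhs_ballP[r /= r0 rO] : nbhs c U.
      by apply: open_nbhs_nbhs; split=> //; exact: BO (NB _ Nc).
    exists r => // u v au uc cv vb cu vc [s [cs sm Fu]].
    exists ((u, v) :: s); rewrite !big_cons /=; split.
    - by split=> //; exact: le_trans cv.
    - have := m_add u v au (le_trans uc cv).
      suff uvO : `[u, v] `<=` U by move=> /(_ uvO); lra.
      move=> x /=; rewrite in_itv /= => /andP[ux xv]; apply: rO.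
      by rewrite /ball /= ltr_norml; apply/andP; split; lra.
    - have Guv : G u <= G v by apply: Gh; lra.
      have := ler_norm (F v - F u); nra.
  have [dF [dG [Fc Gc dFG]]] := FG _ ac_ cb Nc.
  (* As c lies between u and v, the errors at u and v add up to e/4 times v - u for each of [F] and
     [G], which fits in the allowance e (v - u). *)
  have e4 : 0 < e / 4 by lra.
  have [r1 r10 rF] := is_derive_approx _ _ _ _ Fc _ e4.
  have [r2 r20 rG] := is_derive_approx _ _ _ _ Gc _ e4.
  exists (Order.min r1 r2) => [|u v au uc cv vb]; first by rewrite lt_min r10.
  rewrite ltrBlDr -ltrBlDl -(ltrBlDl v c) !lt_min => /andP[u1 u2] /andP[v1 v2] [s [cs sm Fu]].
  exists s; split.
  - by apply: chain_widen cs; lra.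
  - by apply: le_trans sm _; apply: m_le; lra.
  - have := rF u; have := rG u; rewrite (ler0_norm (_ : u - c <= 0)); last lra.
    rewrite opprB => /(_ u2) Gu /(_ u1) {}Fu'.
    have := rF v; have := rG v; rewrite (ger0_norm (_ : 0 <= v - c)); last lra.
    move=> /(_ v2) Gv /(_ v1) Fv.
    move: Gu Fu' Gv Fv.
    rewrite !ler_norml => /andP[? ?] /andP[? ?] /andP[? ?] /andP[? ?].
    nra.
have : \sum_(p <- s) (p.2 - p.1) < d.
  by apply: le_lt_trans sm _; rewrite -lte_fin -mE.
by move=> /(Fd _ cs); lra.
Qed.
End chains.

(** * From the completed Lebesgue measure to the Borel one *)

Section completed.
Context {R : realType}.
Local Notation mu := (@lebesgue_measure R).
Local Notation cmu := (@completed_lebesgue_measure R).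
Local Notation lR := (caratheodory_type ((wlength (@idfun R))^*)%mu).
Local Notation bR := (measurableTypeR R).

Lemma completed_measurableE (E : set lR) : measurable E ->
  exists A N : set bR, [/\ measurable A, mu.-negligible N & E = A `|` N].
Proof.
move=> mE.
have : (completed_algebra_gen mu).-sigma.-measurable E.
  by rewrite completed_caratheodory_measurable.
rewrite g_sigma_completed_algebra_genE => -[A mA [N nN <-]].
by exists A, N.
Qed.

Lemma borel_completed_measurable (E : set bR) :
  measurable E -> measurable (E : set lR).
Proof. exact: sub_caratheodory. Qed.

(* Each set {g > q}, q rational, is Borel up to a null set: kill g on the union
   of these null sets. *)
Lemma completed_measurable_fun_borel (g : lR -> R) : measurable_fun setT g ->
  exists2 N : set bR, measurable N /\ mu N = 0 &
    measurable_fun setT (fun t : bR => if t \in N then 0 else g t).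
Proof.
move=> mg.
(* An enumeration of the rationals; codes that decode to nothing give 0, which is rational as
   well. *)
pose q k : R := ratr (odflt 0 (unpickle k : option rat)).
have mgq k : measurable (g @^-1` `]q k, +oo[).
  by rewrite -[X in measurable X]setTI; apply: mg => //; exact: measurable_itv.
have /choice[A] := fun k => completed_measurableE _ (mgq k).
move=> /choice[M AM].
have : mu.-negligible (\bigcup_k M k).
  by apply: negligible_bigcup => k; have [] := AM k.
case=> N [mN N0 MN]; exists N => //.
pose h t := if t \in N then 0 else g t.
have hq k : measurable (h @^-1` `]q k, +oo[ : set bR).
  (* On [N] the function [h] vanishes, so [N] lies in the superlevel set exactly when [q k] is
     negative. *)
  have -> : h @^-1` `]q k, +oo[ = (A k `\` N) `|` (if q k < 0 then N else set0).
    have [_ _ gAM] := AM k.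
    have gA t : ~ N t -> (A k t <-> q k < g t).
      move=> Nt; have : (g @^-1` `]q k, +oo[) t <-> (A k `|` M k) t by rewrite gAM.
      rewrite /= in_itv /= andbT => H; split=> [At|/H[]//]; first by apply/H; left.
      by move=> Mt; case: Nt; apply: MN; exists k.
    apply/seteqP; split => t; rewrite /h /= in_itv /= andbT; have [tN|tN] := boolP (t \in N).
    - by move=> q0; right; rewrite q0; exact: set_mem.
    - have Nt : ~ N t by move/mem_set; exact/negP.
      by move=> gt; left; split=> //; exact/gA.
    - by move: tN; rewrite inE => Nt [[]//|]; case: ifP.
    - have Nt : ~ N t by move/mem_set; exact/negP.
      by case=> [[/gA]|]; [exact | case: ifP].
  apply: measurableU; first by have [mA _ _] := AM k; exact: measurableD.
  by case: ifP.
apply: (measurability (@RGenOInfty.G R)) => [|_ /= [_ [x ->] <-]].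
  exact: RGenOInfty.measurableE.
rewrite setTI.
have -> : h @^-1` `]x, +oo[ = \bigcup_k (if x < q k then h @^-1` `]q k, +oo[ else set0).
  apply/seteqP; split => t /=.
    rewrite in_itv /= andbT => xh.
    have [r] := rat_in_itvoo xh; rewrite in_itv /= => /andP[xr rh].
    have qr : q (pickle r) = ratr r by rewrite /q pickleK.
    by exists (pickle r) => //=; rewrite qr xr /= in_itv /= rh.
  case=> k _ /=; case: ifP => //= xq; rewrite !in_itv /= !andbT; exact: lt_trans.
by apply: bigcupT_measurable => k; case: ifP.
Qed.

Lemma completed_integrable_borel (g : R -> R) (t0 : R) :
  (forall t, t0 <= t -> 0 <= g t) ->
  measurable_fun (`[t0, +oo[%classic : set lR) g ->
  (\int[cmu]_(t in `[t0, +oo[) (g t)%:E < +oo)%E ->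
  exists2 h : bR -> R,
    [/\ mu.-integrable setT (EFin \o h) & forall t, 0 <= h t] &
    {ae mu, forall t, t0 <= t -> h t = g t}.
Proof.
move=> g0 mg ig.
have mD : measurable (`[t0, +oo[%classic : set lR).
  by apply: borel_completed_measurable; exact: measurable_itv.
pose g1 : lR -> R := g \_ `[t0, +oo[%classic.
have mg1 : measurable_fun setT g1 by apply/measurable_restrict; rewrite ?setTI.
have g1E t : g1 t = if t \in `[t0, +oo[%classic then g t else 0 by rewrite /g1 patchE.
have g10 t : 0 <= g1 t.
  by rewrite g1E; case: ifP => // /set_mem /=; rewrite in_itv /= andbT => /g0.
have [N [mN N0] mh] := completed_measurable_fun_borel _ mg1.
set h := fun t => _ in mh.
have h0 t : 0 <= h t by rewrite /h; case: ifP.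
have mhE : measurable_fun setT (EFin \o h) by exact/measurable_EFinP.
exists h.
  split=> //; apply/integrableP; split=> //.
  rewrite (eq_integral (EFin \o h)); last first.
    by move=> t _ /=; rewrite ger0_norm.
  (* On Borel sets [mu] is the pushforward of [cmu] under the identity, so the integral of the Borel
     function [h] can be computed with [cmu] and compared there with that of [g]. *)
  have mid : measurable_fun (setT : set lR) (id : lR -> bR).
    by move=> _ Y mY; rewrite setTI; exact: borel_completed_measurable.
  rewrite (@eq_measure_integral _ _ _ setT (pushforward cmu (id : lR -> bR))) //.
  rewrite (ge0_integral_pushforward mid) //; last first.
    by move=> t _; rewrite lee_fin.
  rewrite preimage_setT.
  apply: le_lt_trans ig.
  rewrite [leRHS]integral_mkcond.
  apply: (@ge0_le_integral _ lR R cmu setT).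
  - exact: measurableT.
  - by move=> t _; rewrite lee_fin.
  - exact: (measurableT_comp mhE mid).
  - apply: (iffLR (@measurable_restrictT _ _ lR _ _ (fun t => (g t)%:E) mD)).
    exact/measurable_EFinP.
  - move=> t _; rewrite patchE /= /h g1E.
    case: (t \in N); last by case: ifP.
    by case: ifP => // /set_mem /=; rewrite in_itv /= andbT lee_fin => /g0.
exists N; split => // t /= /not_implyP[tt0]; rewrite /h g1E.
case: ifP => [/set_mem //|_].
by rewrite mem_set //= in_itv /= tt0.
Qed.

(** [G] integrates a nonnegative Borel version of [g] from -oo: this makes it monotone on the whole
    line and bounded by the total mass, and Lebesgue differentiation gives its derivative almost
    everywhere. These are the properties that [gronwall_ae] and the final bound use. *)
Lemma completed_primitive (g : R -> R) (t0 : R) :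
  (forall t, t0 <= t -> 0 <= g t) ->
  measurable_fun (`[t0, +oo[%classic : set lR) g ->
  (\int[cmu]_(t in `[t0, +oo[) (g t)%:E < +oo)%E ->
  exists G : R -> R, [/\ {homo G : u v / u <= v}, (exists M, forall t, G t <= M) &
    {ae mu, forall t, t0 <= t -> is_derive t 1 G (g t)}].
Proof.
move=> g0 mg ig.
have [h [ih h0] hg] := completed_integrable_borel _ _ g0 mg ig.
pose G x := \int[mu]_(t in `]-oo, x]) h t.
have iS t : mu.-integrable `]-oo, t] (EFin \o h).
  by apply: integrableS ih => //; exact: measurable_itv.
have mh : measurable_fun setT (EFin \o h) by case/integrableP: ih.
have fS (A : set bR) : measurable A -> (\int[mu]_(t in A) (h t)%:E)%E \is a fin_num.
  move=> mA; apply: integrable_fin_num => //; exact: integrableS ih.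
have GE A C : measurable (A : set bR) -> measurable (C : set bR) -> A `<=` C ->
    \int[mu]_(t in A) h t <= \int[mu]_(t in C) h t.
  move=> mA mC AC; rewrite /Rintegral fine_le ?fS //.
  apply: ge0_subset_integral => //; first exact: measurable_funS mh.
  by move=> t _; rewrite lee_fin.
exists G; split.
- move=> u v uv; apply: GE; try exact: measurable_itv.
  by apply: subset_itvl; rewrite bnd_simp.
- exists (\int[mu]_(t in setT) h t) => t; apply: GE => //; exact: measurable_itv.
have lh : locally_integrable setT (h : R -> R).
  by apply: open_integrable_locally => //; exact: openT.
have := FTC1Ny iS lh.
apply: filterS2 hg; first exact: (ae_filter_ringOfSetsType mu).
move=> t ht [dG Gt] tt0.
by apply: DeriveDef => //; rewrite -derive1E Gt ht.
Qed.

End completed.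

(** * Scalar derivatives, monotonicity and Lipschitz bounds *)

Section real_derivatives.
Context {R : realType}.
Implicit Types (F G : R -> R) (t dF dG : R).

Lemma derD F G t dF dG : is_derive t 1 F dF -> is_derive t 1 G dG ->
  is_derive t 1 (fun s => F s + G s) (dF + dG).
Proof. by move=> ? ?; exact: is_deriveD. Qed.

Lemma derM F G t dF dG : is_derive t 1 F dF -> is_derive t 1 G dG ->
  is_derive t 1 (fun s => F s * G s) (dF * G t + F t * dG).
Proof.
move=> dF' dG'; have := is_deriveM dF' dG'.
by rewrite /GRing.scale /= addrC [G t * _]mulrC.
Qed.

Lemma der_cst (k t : R) : is_derive t 1 (fun=> k) 0.
Proof. exact: is_derive_cst. Qed.

Lemma der_sum n (F : 'I_n -> R -> R) t (dF : 'I_n -> R) :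
  (forall i, is_derive t 1 (F i) (dF i)) ->
  is_derive t 1 (fun s => \sum_(i < n) F i s) (\sum_(i < n) dF i).
Proof.
move=> H; have := is_derive_sum H.
by congr is_derive; apply/funext => s; rewrite fct_sumE.
Qed.

(** [G - F] and [G + F] both have nonnegative derivatives. This replaces the estimate of an integral
    of [dF] by that of [dG], with no integrability to check. *)
Lemma der_le_ndecr F G (dF dG : R -> R) (a t : R) : a <= t ->
  (forall s, a <= s -> is_derive s 1 F (dF s)) ->
  (forall s, a <= s -> is_derive s 1 G (dG s)) ->
  (forall s, a <= s -> `|dF s| <= dG s) -> `|F t - F a| <= G t - G a.
Proof.
move=> at_ HF HG FG.
have ndecr (H dH : R -> R) : (forall s, a <= s -> is_derive s 1 H (dH s)) ->
    (forall s, a <= s -> 0 <= dH s) -> H a <= H t.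
  move=> Hd Hp; apply: (@ger0_derive1_ndecr R H a t) => //.
  - by move=> s; rewrite in_itv /= => /andP[/ltW as_ _]; have [] := Hd s as_.
  - move=> s; rewrite in_itv /= => /andP[/ltW as_ _].
    by rewrite derive1E (@derive_val _ _ _ _ _ _ _ (Hd s as_)) Hp.
  - apply: derivable_within_continuous => s; rewrite in_itv /= => /andP[as_ _].
    by have [] := Hd s as_.
have FM s : a <= s -> is_derive s 1 (fun r => -1 * F r) (0 * F s + -1 * dF s).
  by move=> as_; exact: (derM _ _ _ _ _ (der_cst _ _) (HF s as_)).
have H1 := ndecr _ _ (fun s as_ => derD _ _ _ _ _ (HG s as_) (FM s as_)).
have H2 := ndecr _ _ (fun s as_ => derD _ _ _ _ _ (HG s as_) (HF s as_)).
rewrite ler_norml; apply/andP; split.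
  have : forall s, a <= s -> 0 <= dG s + dF s.
    by move=> s /FG; rewrite ler_norml => /andP[? ?]; lra.
  by move=> /H2; lra.
have : forall s, a <= s -> 0 <= dG s + (0 * F s + -1 * dF s).
  by move=> s /FG; rewrite ler_norml => /andP[? ?]; lra.
by move=> /H1; lra.
Qed.

Lemma within_bounded F (a b : R) : a <= b -> {within `[a, b], continuous F} ->
  bnd a b F.
Proof.
move=> ab cF.
have [c _ Fc] := EVT_max ab cF; have [d _ Fd] := EVT_min ab cF.
exists (`|F c| + `|F d|) => t at_ tb.
have tab : t \in `[a, b] by rewrite in_itv /= at_.
have := Fc _ tab; have := Fd _ tab.
have := ler_norm (F c); have := ler_norm (- F d); rewrite normrN.
have := normr_ge0 (F c); have := normr_ge0 (F d).
rewrite ler_norml; lra.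
Qed.

Lemma ac_bnd_C1 F (dF : R -> R) (a b : R) : a <= b ->
  (forall s, a <= s -> is_derive s 1 F (dF s)) ->
  bnd a b dF -> ac_bnd a b F.
Proof.
move=> ab HF [M HM]; apply: (@ac_bnd_lip _ _ _ _ M) => u v au uv vb.
have cF : {within `[u, v], continuous F}.
  apply: derivable_within_continuous => s; rewrite in_itv /= => /andP[us _].
  by have [] := HF s (le_trans au us).
have [|c cuv ->] := @MVT_segment R F dF u v uv _ cF.
  by move=> s; rewrite in_itv /= => /andP[/ltW us _]; apply: HF; exact: le_trans us.
move: cuv; rewrite in_itv /= => /andP[uc cv].
rewrite normrM (ger0_norm (_ : 0 <= v - u)) ?subr_ge0 // ler_wpM2r ?subr_ge0 //.
by apply: HM; lra.
Qed.

End real_derivatives.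

(** * One-sided and coordinatewise derivatives *)

Section from.
Context {R : realType} {V : normedModType R}.

(** For increments smaller than t - t0 the constraint is automatic. *)
Lemma within_from_dnbhs (t0 t : R) : t0 < t ->
  within [set h | t0 <= t + h] (0 : R)^' = (0 : R)^'.
Proof.
move=> tt0; apply/seteqP; split => A; last exact: cvg_within.
rewrite /within /=.
have H : \forall h \near (0 : R)^', t0 <= t + h.
  apply: nbhs_dnbhs; apply/nbhs_ballP; exists (t - t0); rewrite /= ?subr_gt0 //.
  by move=> h; rewrite /ball /= sub0r normrN ltr_norml => /andP[? ?]; lra.
by move=> WA; apply: filterS2 H WA => h th; exact.
Qed.

Lemma derivable_from_is_derive (t0 : R) (g : R -> V) (t : R) : t0 < t ->
  derivable_from t0 g t -> is_derive t 1 g (derive_from t0 g t).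
Proof.
move=> tt0; rewrite /derivable_from /derive_from within_from_dnbhs // => H.
have E : (fun h => h^-1 *: (g (t + h) - g t)) =
   (fun h : R => h^-1 *: ((g \o shift t) (h *: 1) - g t)).
  by apply/funext => h /=; rewrite [h *: 1]mulr1 [h + t]addrC.
rewrite E in H *.
by split.
Qed.

End from.

Lemma is_derive_coord {R : realType} {n : nat} (g : R -> 'cV[R]_n) (t : R) l i :
  is_derive t 1 g l -> is_derive t 1 (fun s => g s i 0) (l i 0).
Proof.
move=> [dg <-].
have H : h^-1 *: (g (h *: 1 + t) i 0 - g t i 0) @[h --> 0^'] --> ('D_1 g t) i 0.
  have -> : (fun h : R => h^-1 *: (g (h *: 1 + t) i 0 - g t i 0)) =
     (fun M : 'cV[R]_n => M i 0) \o (fun h : R => h^-1 *: (g (h *: 1 + t) - g t)).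
    by apply/funext => h /=; rewrite !mxE.
  by apply: continuous_cvg; [exact: coord_continuous | exact: dg].
split; first by apply/cvg_ex; exists ('D_1 g t i 0).
exact: (cvg_lim _ H).
Qed.

(** * Inner product and Euclidean norm *)

Section dot_product.
Context {R : realType}.

Definition dot {n : nat} (u v : 'cV[R]_n) : R := (u^T *m v) 0 0.

Lemma dotE n (u v : 'cV[R]_n) : dot u v = \sum_(i < n) u i 0 * v i 0.
Proof. by rewrite /dot mxE; apply: eq_bigr => i _; rewrite mxE. Qed.

Lemma dotC n (u v : 'cV[R]_n) : dot u v = dot v u.
Proof. by rewrite !dotE; apply: eq_bigr => i _; rewrite mulrC. Qed.

Lemma dotDr n (u v w : 'cV[R]_n) : dot u (v + w) = dot u v + dot u w.
Proof. by rewrite /dot mulmxDr mxE. Qed.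

Lemma dotZr n (u v : 'cV[R]_n) k : dot u (k *: v) = k * dot u v.
Proof. by rewrite /dot -scalemxAr mxE. Qed.

Lemma dotNr n (u v : 'cV[R]_n) : dot u (- v) = - dot u v.
Proof. by rewrite -scaleN1r dotZr mulN1r. Qed.

Lemma dotDl n (u v w : 'cV[R]_n) : dot (v + w) u = dot v u + dot w u.
Proof. by rewrite !(dotC _ _ u) dotDr. Qed.

Lemma dotZl n (u v : 'cV[R]_n) k : dot (k *: v) u = k * dot v u.
Proof. by rewrite !(dotC _ _ u) dotZr. Qed.

Lemma dotNl n (u v : 'cV[R]_n) : dot (- v) u = - dot v u.
Proof. by rewrite !(dotC _ _ u) dotNr. Qed.

Lemma dot_mulmx m n (A : 'M[R]_(m, n)) u v : dot u (A *m v) = dot (A^T *m u) v.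
Proof. by rewrite /dot trmx_mul trmxK mulmxA. Qed.

Lemma dot_ge0 n (u : 'cV[R]_n) : 0 <= dot u u.
Proof. by rewrite dotE; apply: sumr_ge0 => i _; rewrite -expr2 sqr_ge0. Qed.

Lemma dot_delta n (u : 'cV[R]_n) i : dot u (delta_mx i 0) = u i 0.
Proof.
rewrite dotE (bigD1 i) //= mxE !eqxx mulr1 big1 ?addr0 // => j ji.
by rewrite mxE (negbTE ji) mulr0.
Qed.

Lemma enorm_ge0 n (u : 'cV[R]_n) : 0 <= enorm u.
Proof. exact: sqrtr_ge0. Qed.

Lemma enorm_coord n (u : 'cV[R]_n) i : `|u i 0| <= enorm u.
Proof.
rewrite -sqrtr_sqr /enorm ler_wsqrtr // (bigD1 i) //= lerDl.
by apply: sumr_ge0 => j _; rewrite sqr_ge0.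
Qed.

Lemma enorm_le_sum n (u : 'cV[R]_n) : enorm u <= \sum_(i < n) `|u i 0|.
Proof.
set S := (X in _ <= X).
have S0 : 0 <= S by apply: sumr_ge0.
rewrite -[leRHS]ger0_norm // -sqrtr_sqr ler_wsqrtr // expr2 {1}/S mulr_suml.
apply: ler_sum => i _; rewrite -real_normK ?num_real // expr2 ler_wpM2l //.
by rewrite /S (bigD1 i) //= lerDl; apply: sumr_ge0.
Qed.

(* AM-GM, from the nonnegativity of the squared norm of |w| v - w. *)
Lemma dot_le_enorm n (v w : 'cV[R]_n) : dot v w <= enorm w * ((1 + dot v v) / 2).
Proof.
have ww : dot w w = enorm w ^+ 2.
  rewrite dotE /enorm sqr_sqrtr; first by apply: eq_bigr => i _; rewrite expr2.
  by apply: sumr_ge0 => i _; rewrite sqr_ge0.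
have [w0|w0] := eqVneq (enorm w) 0.
  rewrite w0 mul0r dotE big1 // => i _.
  have := enorm_coord _ w i; rewrite w0 normr_le0 => /eqP ->; exact: mulr0.
have {}w0 : 0 < enorm w by rewrite lt_neqAle eq_sym w0 enorm_ge0.
have := dot_ge0 _ (enorm w *: v - w).
rewrite dotDl !dotDr !dotNl !dotNr !dotZl !dotZr (dotC _ w v) ww => H.
have : 0 <= enorm w * (enorm w * ((1 + dot v v) / 2) - dot v w) by lra.
by rewrite pmulr_rge0 // subr_ge0.
Qed.

End dot_product.

(** * Gradients of convex functions and the chain rule *)

Section gradient.
Context {R : realType} {n : nat}.
Implicit Types (f : 'cV[R]_n -> R) (x : R -> 'cV[R]_n).

Lemma col_sum_delta (v : 'cV[R]_n) : v = \sum_(i < n) v i 0 *: delta_mx i 0.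
Proof.
apply/colP => i; rewrite summxE (bigD1 i) //= !mxE !eqxx mulr1 big1 ?addr0 // => j ji.
by rewrite !mxE eq_sym (negbTE ji) mulr0.
Qed.

Lemma derive_grad f z v : differentiable f z -> 'D_v f z = dot (grad f z) v.
Proof.
move=> df; rewrite deriveE // {1}(col_sum_delta v) linear_sum dotE.
by apply: eq_bigr => i _; rewrite linearZ /= mxE deriveE // mulrC.
Qed.

(** Convexity bounds the difference quotient of [f] at [z] towards [y] by f(y) - f(z) for every step
    in (0, 1]; the directional derivative is its limit. *)
Lemma convex_grad f z y : convex_function [set: 'cV[R]_n] f ->
  differentiable f z -> dot (grad f z) (y - z) <= f y - f z.
Proof.
move=> cf df; rewrite -derive_grad //.
have /cvgrPdist_le dfv := diff_derivable (v := y - z) df.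
apply/ler_addgt0Pr => e e0.
have /nbhs_ballP[r /= r0 rP] := dfv e e0.
(* At most 1 to be a convex weight, below [r] to be in the range where the difference quotient is
   close to its limit. *)
pose h := Order.min 1 (r / 2).
have h0 : 0 < h by rewrite /h lt_min; apply/andP; split; lra.
have h1 : h <= 1 by rewrite /h ge_min lexx.
have hr : h < r by rewrite /h gt_min; apply/orP; right; lra.
have /= := rP h; rewrite /ball /= sub0r normrN (gtr0_norm h0) => /(_ hr (lt0r_neq0 h0)).
have := cf (Itv01 (ltW h0) h1) y z (in_setT _) (in_setT _).
rewrite convRE /conv /= /unstable.onem -/(derive f z (y - z)).
have -> : h *: (y - z) + z = h *: y + (1 - h) *: z.
  by rewrite scalerBr scalerBl scale1r -addrA [- _ + z]addrC.
set w := f (_ + _) => cw.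
rewrite ler_norml /GRing.scale /= => /andP[_].
have : h^-1 * (w - f z) <= f y - f z by rewrite mulrC ler_pdivrMr //; lra.
lra.
Qed.

Lemma is_derive_comp_grad f x t l : differentiable f (x t) ->
  is_derive t 1 x l -> is_derive t 1 (fun s => f (x s)) (dot (grad f (x t)) l).
Proof.
move=> df dx.
have /derivable1_diffP dx' : derivable x t 1 by [].
have dc := differentiable_comp dx' df.
apply: DeriveDef; first exact/derivable1_diffP.
rewrite -derive_grad // [RHS]deriveE // -[fun s => f (x s)]/(f \o x) (deriveE _ dc) diff_comp //=.
by congr ('d f (x t) _); rewrite -deriveE //; exact: derive_val.
Qed.

End gradient.

(** * Bounds and absolute continuity along the trajectory *)

Section bounded.
Context {R : realType}.
Implicit Types (F G : R -> R).

Lemma bnd_mul (a b : R) F G : bnd a b F -> bnd a b G -> bnd a b (fun t => F t * G t).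
Proof.
move=> [M FM] [N GN]; exists (M * N) => t at_ tb.
by rewrite normrM ler_pM ?FM ?GN.
Qed.

Lemma bnd_sum (a b : R) n (F : 'I_n -> R -> R) : (forall i, bnd a b (F i)) ->
  bnd a b (fun t => \sum_(i < n) F i t).
Proof.
move=> /choice[M FM]; exists (\sum_(i < n) M i) => t at_ tb.
apply: le_trans (ler_norm_sum _ _ _) _.
by apply: ler_sum => i _; exact: FM.
Qed.

Lemma bnd_der (a b : R) F (dF : R -> R) : a <= b ->
  (forall t, a <= t -> is_derive t 1 F (dF t)) -> bnd a b F.
Proof.
move=> ab HF; apply: within_bounded => //.
apply: derivable_within_continuous => s; rewrite in_itv /= => /andP[as_ _].
by have [] := HF s as_.
Qed.

(* By convexity, +- grad f(z)_i <= f(z +- e_i) - f(z), which is continuous along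
   the curve; no continuity of grad f is needed. *)
Lemma grad_comp_bnd n (f : 'cV[R]_n -> R) x (dx : R -> 'cV[R]_n) (a b : R) i :
  convex_function [set: 'cV[R]_n] f -> (forall z, differentiable f z) -> a <= b ->
  (forall t, a <= t -> is_derive t 1 x (dx t)) ->
  bnd a b (fun t => grad f (x t) i 0).
Proof.
move=> cf df ab Hx.
have shift v : bnd a b (fun t => f (x t + v)).
  apply: (@bnd_der _ _ _ (fun t => dot (grad f (x t + v)) (dx t))) => // t at_.
  apply: (@is_derive_comp_grad _ _ f (fun s => x s + v)) => //.
  have := is_deriveD (Hx t at_) (is_derive_cst v t 1).
  by rewrite addr0.
have [M0 H0] := shift 0; have [M1 H1] := shift (delta_mx i 0).
have [M2 H2] := shift (- delta_mx i 0).
exists (M0 + M1 + M2) => t at_ tb.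
have := H0 t at_ tb; have := H1 t at_ tb; have := H2 t at_ tb; rewrite addr0.
have := convex_grad f (x t) (x t + delta_mx i 0) cf (df _).
have := convex_grad f (x t) (x t - delta_mx i 0) cf (df _).
rewrite !(addrC (x t)) !addrK dotNr dot_delta !ler_norml.
move=> ? ? /andP[? ?] /andP[? ?] /andP[? ?]; apply/andP; split; lra.
Qed.

Lemma ac_bnd_convex_comp n (f : 'cV[R]_n -> R) x (dx : R -> 'cV[R]_n) (a b : R) :
  convex_function [set: 'cV[R]_n] f -> (forall z, differentiable f z) -> a <= b ->
  (forall t, a <= t -> is_derive t 1 x (dx t)) ->
  (forall i, bnd a b (fun t => dx t i 0)) ->
  ac_bnd a b (fun t => f (x t)).
Proof.
move=> cf df ab Hx Bx.
apply: (@ac_bnd_C1 _ _ (fun t => dot (grad f (x t)) (dx t))) => //.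
  by move=> t at_; apply: is_derive_comp_grad => //; exact: Hx.
suff : bnd a b (fun t => \sum_(i < n) grad f (x t) i 0 * dx t i 0).
  by case=> M HM; exists M => t at_ tb; rewrite dotE; exact: HM.
by apply: bnd_sum => i; apply: bnd_mul => //; exact: (grad_comp_bnd _ _ _ dx).
Qed.

(** Passes from disjoint indexed families to chains: the intervals of a chain are ordered, hence
    disjoint, and a coordinate is bounded by the norm. *)
Lemma loc_ac n (g : R -> 'cV[R]_n) t0 a b i : t0 <= a -> a <= b ->
  loc_abs_continuous_from t0 g -> ac a b (fun t => g t i 0).
Proof.
move=> t0a ab ag e e0; have [d d0 dP] := ag a b t0a ab e e0.
exists d => // s cs sd.
pose u (j : 'I_(size s)) := (nth (0, 0) s j).1.
pose v (j : 'I_(size s)) := (nth (0, 0) s j).2.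
have uv j : [/\ a <= u j, u j <= v j & v j <= b].
  by apply: (chain_mem _ _ _ _ cs); exact: mem_nth.
apply: le_lt_trans (dP _ u v uv _ _); last 2 first.
- apply/trivIsetP => j k _ _ jk; rewrite -subset0 => r [] /=.
  rewrite !in_itv /= => /andP[uj vj] /andP[uk vk].
  have : j != k :> nat by [].
  rewrite neq_ltn => /orP[jk'|jk'].
    have := chain_nth_lt _ _ _ _ _ cs jk' (ltn_ord k).
    by rewrite -/(u j) -/(v k); lra.
  have := chain_nth_lt _ _ _ _ _ cs jk' (ltn_ord j).
  by rewrite -/(u k) -/(v j); lra.
- by move: sd; rewrite (big_nth (0, 0)) big_mkord.
rewrite (big_nth (0, 0)) big_mkord; apply: ler_sum => j _.
have := enorm_coord _ (g (v j) - g (u j)) i.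
by rewrite !mxE.
Qed.

End bounded.

(** * Calculus of vector-valued functions *)

Section vector_derivatives.
Context {R : realType}.

(** Coordinatewise, so that every vector rule reduces to the scalar sum and product rules. *)
Definition vder {n : nat} (U : R -> 'cV[R]_n) (t : R) (dU : 'cV[R]_n) : Prop :=
  forall i, is_derive t 1 (fun s => U s i 0) (dU i 0).

Lemma der_ext (F G : R -> R) (t dF dG : R) : is_derive t 1 F dF ->
  F =1 G -> dF = dG -> is_derive t 1 G dG.
Proof. by move=> H /funext <- <-. Qed.

Lemma vder_cst n (v : 'cV[R]_n) (t : R) : vder (fun=> v) t 0.
Proof. by move=> i; rewrite mxE; exact: der_cst. Qed.

Lemma vderD n (U W : R -> 'cV[R]_n) (t : R) dU dW : vder U t dU -> vder W t dW ->
  vder (fun s => U s + W s) t (dU + dW).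
Proof.
move=> HU HW i; apply: (der_ext _ _ _ _ _ (derD _ _ _ _ _ (HU i) (HW i))) => [s|];
  by rewrite mxE.
Qed.

Lemma vderZ n (k : R -> R) (U : R -> 'cV[R]_n) (t dk : R) dU :
  is_derive t 1 k dk -> vder U t dU ->
  vder (fun s => k s *: U s) t (dk *: U t + k t *: dU).
Proof.
move=> Hk HU i; apply: (der_ext _ _ _ _ _ (derM _ _ _ _ _ Hk (HU i))) => [s|];
  by rewrite !mxE.
Qed.

Lemma vderMl m n (A : 'M[R]_(m, n)) (U : R -> 'cV[R]_n) (t : R) dU : vder U t dU ->
  vder (fun s => A *m U s) t (A *m dU).
Proof.
move=> HU i.
apply: (der_ext _ _ _ _ _ (der_sum _ _ _ _ (fun j =>
  derM _ _ _ _ _ (der_cst (A i j) t) (HU j)))) => [s|]; rewrite mxE //.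
by apply: eq_bigr => j _; rewrite mul0r add0r.
Qed.

Lemma der_dot n (U W : R -> 'cV[R]_n) (t : R) dU dW : vder U t dU -> vder W t dW ->
  is_derive t 1 (fun s => dot (U s) (W s)) (dot dU (W t) + dot (U t) dW).
Proof.
move=> HU HW.
apply: (der_ext _ _ _ _ _ (der_sum _ _ _ _ (fun j =>
  derM _ _ _ _ _ (HU j) (HW j)))) => [s|]; rewrite !dotE //.
by rewrite big_split.
Qed.

Definition vac_bnd {n : nat} (a b : R) (U : R -> 'cV[R]_n) : Prop :=
  forall i, ac_bnd a b (fun s => U s i 0).

Lemma vac_bnd_cst n (v : 'cV[R]_n) a b : vac_bnd a b (fun=> v).
Proof. by move=> i; exact: ac_bnd_cst. Qed.

Lemma ac_bnd_ext a b (F G : R -> R) : ac_bnd a b F -> F =1 G -> ac_bnd a b G.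
Proof. by move=> H /funext <-. Qed.

Lemma vac_bndD n (U W : R -> 'cV[R]_n) a b : vac_bnd a b U -> vac_bnd a b W ->
  vac_bnd a b (fun s => U s + W s).
Proof.
by move=> HU HW i; apply: ac_bnd_ext (ac_bndD _ _ _ _ (HU i) (HW i)) _ => s; rewrite mxE.
Qed.

Lemma vac_bndZ n (k : R -> R) (U : R -> 'cV[R]_n) a b : ac_bnd a b k -> vac_bnd a b U ->
  vac_bnd a b (fun s => k s *: U s).
Proof.
by move=> Hk HU i; apply: ac_bnd_ext (ac_bndM _ _ _ _ Hk (HU i)) _ => s; rewrite mxE.
Qed.

Lemma vac_bndMl m n (A : 'M[R]_(m, n)) (U : R -> 'cV[R]_n) a b : vac_bnd a b U ->
  vac_bnd a b (fun s => A *m U s).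
Proof.
move=> HU i; apply: ac_bnd_ext (ac_bnd_sum _ _ _ _ (fun j => ac_bndM _ _ _ _
  (ac_bnd_cst _ _ (A i j)) (HU j))) _ => s; by rewrite mxE.
Qed.

Lemma ac_bnd_dot n (U W : R -> 'cV[R]_n) a b : vac_bnd a b U -> vac_bnd a b W ->
  ac_bnd a b (fun s => dot (U s) (W s)).
Proof.
move=> HU HW; apply: ac_bnd_ext (ac_bnd_sum _ _ _ _ (fun j => ac_bndM _ _ _ _
  (HU j) (HW j))) _ => s; by rewrite dotE.
Qed.

End vector_derivatives.

(** * A Gronwall inequality holding almost everywhere *)

Lemma dot0l (R : realType) n (u : 'cV[R]_n) : dot 0 u = 0.
Proof. by rewrite /dot trmx0 mul0mx mxE. Qed.

(** The logarithm turns the hypothesis into (ln (1 + E))' <= G', to which [ac_derive_le] applies: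
    [ln] is 1-Lipschitz on [1, +oo[ and E >= 0, so ln (1 + E) inherits absolute continuity. *)
Lemma gronwall_ae (R : realType) (a b : R) (E G g : R -> R) (N : set R) :
  a <= b -> ac a b E -> (forall t, a <= t -> t <= b -> 0 <= E t) ->
  {homo G : u v / u <= v} -> (@lebesgue_measure R).-negligible N ->
  (forall t, a <= t -> t <= b -> ~ N t -> is_derive t 1 G (g t) /\
    exists dE : R, is_derive t 1 E dE /\ dE <= g t * (1 + E t)) ->
  ln (1 + E b) - ln (1 + E a) <= G b - G a.
Proof.
move=> ab aE E0 Gh nN H.
apply: (@ac_derive_le R a b (fun t => ln (1 + E t)) G N ab _ Gh nN).
  apply: (@ac_comp_le R a b _ E E 1) => // u v au uv vb.
  have Eu := E0 u au (le_trans uv vb); have Ev := E0 v (le_trans au uv) vb.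
  have ln_lip (p q : R) : 0 <= p -> p <= q -> `|ln (1 + q) - ln (1 + p)| <= q - p.
    move=> p0 pq.
    rewrite ger0_norm ?subr_ge0; last by rewrite ler_ln ?posrE; lra.
    rewrite -ln_div ?posrE; try lra.
    have -> : (1 + q) / (1 + p) = 1 + (q - p) / (1 + p) by field; lra.
    apply: le_trans (le_ln1Dx _) _.
      by apply: lt_le_trans (_ : 0 <= _) => //; rewrite divr_ge0 //; lra.
    by rewrite ler_pdivrMr; nra.
  have := normr_ge0 (E v - E u).
  case: (leP (E u) (E v)) => [uv'|/ltW uv'].
    by have := ln_lip _ _ Eu uv'; rewrite (ger0_norm (_ : 0 <= E v - E u)) ?subr_ge0 //; lra.
  rewrite (distrC (E v)) (distrC (ln (1 + E v))).
  by have := ln_lip _ _ Ev uv'; rewrite (ger0_norm (_ : 0 <= E u - E v)) ?subr_ge0 //; lra.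
move=> t at_ tb Nt; have [dG [dE [HE dEg]]] := H t at_ tb Nt.
have E1 : 0 < 1 + E t by have := E0 t at_ tb; lra.
exists ((1 + E t)^-1 * (0 + dE)), (g t); split=> //.
  exact: (@is_derive1_comp R (@ln R) (fun s => 1 + E s) t _ _
    (is_derive1_ln E1) (derD _ _ _ _ _ (der_cst _ _) HE)).
by rewrite add0r mulrC ler_pdivrMr.
Qed.

(** * The energy and its derivative *)

Section lyapunov.
Context {R : realType} {n m : nat} (f : 'cV[R]_n -> R) (A : 'M[R]_(m, n))
  (b : 'cV[R]_m) (alpha : R) (beta : R -> R) (x dx : R -> 'cV[R]_n)
  (lam : R -> 'cV[R]_m) (xs : 'cV[R]_n) (lams : 'cV[R]_m).
Context (alpha_gt1 : 1 < alpha)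
  (f_convex : convex_function [set: 'cV[R]_n] f)
  (f_diff : forall z, differentiable f z)
  (kkt : KKT_set f A b (xs, lams)).

Let c := (alpha - 1)^-1.
(** With L(y, l) = f(y) + <l, A y - b>, this is L(x, lams) - L(xs, lams), because A xs = b. *)
Let gap t := f (x t) - f xs + dot lams (A *m x t - b).
Let v t := x t - xs + (c * t) *: dx t.

(** The weights are dictated by cancellation: c^2 matches the <w, x'> term from the derivative of
    |v|^2/2, where w is the gradient of the Lagrangian at (x, lams), and c/2 matches its <v, A^T
    (lam - lams)> term. *)
Definition energy t := c * c * (t * t * beta t * gap t) + dot (v t) (v t) / 2 +
  c / 2 * dot (lam t - lams) (lam t - lams).

Lemma lagrangian_gap_ge0 t : 0 <= gap t.
Proof.
have [/= gk Ab] := kkt.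
have := convex_grad f xs (x t) f_convex (f_diff xs).
rewrite -gk dotNl -dot_mulmx mulmxBr Ab /gap; lra.
Qed.

Lemma energy_ge t : 0 < beta t ->
  [/\ c * c * (t * t * beta t * gap t) <= energy t,
      dot (v t) (v t) / 2 <= energy t &
      c / 2 * dot (lam t - lams) (lam t - lams) <= energy t].
Proof.
move=> bt; have c0 : 0 < c by rewrite invr_gt0 subr_gt0.
have h1 : 0 <= c * c * (t * t * beta t * gap t).
  apply: mulr_ge0; first by rewrite -expr2 sqr_ge0.
  by rewrite mulr_ge0 ?lagrangian_gap_ge0 // mulr_ge0 ?(ltW bt) // -expr2 sqr_ge0.
have h2 := dot_ge0 _ (v t).
have h3 : 0 <= c / 2 * dot (lam t - lams) (lam t - lams).
  by rewrite mulr_ge0 ?dot_ge0 // divr_ge0 // ltW.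
rewrite /energy; split; lra.
Qed.

(** After the cancellations, E' = c t (c (2 beta + t beta') gap - beta <x - xs, w> + <v, e>). The
    growth condition and convexity make the first two terms nonpositive together. *)
Lemma energy_derive t ddx dlam db e : 0 < t -> 0 < beta t ->
  is_derive t 1 x (dx t) -> vder dx t ddx -> vder lam t dlam ->
  is_derive t 1 beta db -> t * db <= (alpha - 3) * beta t ->
  ddx + (alpha / t) *: dx t = - beta t *: (grad f (x t) + A^T *m lam t) + e ->
  dlam = (t * beta t) *: (A *m (x t + (t / (alpha - 1)) *: dx t) - b) ->
  exists dE : R, is_derive t 1 energy dE /\
    dE <= c * (t * enorm e) * (1 + energy t).
Proof.
move=> t0 bt Hx Hdx Hlam Hb db_le eq1 eq2.
have [/= gk Ab] := kkt.
have a1 : alpha - 1 != 0 by rewrite lt0r_neq0 // subr_gt0.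
have c0 : 0 < c by rewrite invr_gt0 subr_gt0.
have cE : c * (alpha - 1) = 1 by rewrite mulVf.
have vx : vder x t (dx t) by move=> i; exact: is_derive_coord.
set w := grad f (x t) + A^T *m lams.
set mul := lam t - lams.
have Hgap : is_derive t 1 gap (dot w (dx t)).
  have H1 := is_derive_comp_grad f x t (dx t) (f_diff _) Hx.
  have H2 := der_dot _ _ _ _ _ _ (vder_cst _ lams t)
     (vderD _ _ _ _ _ _ (vderMl _ _ A _ _ _ vx) (vder_cst _ (- b) t)).
  apply: (der_ext _ _ _ _ _ (derD _ _ _ _ _ (derD _ _ _ _ _ H1 (der_cst (- f xs) t)) H2)) => //.
  by rewrite !addr0 dot0l add0r /w dotDl dot_mulmx.
(* No [dx] appears: its coefficient in the derivative of [v] is 1 + c - c alpha, which vanishes for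
   c = 1/(alpha-1). *)
set dv := (c * t) *: (- beta t *: (w + A^T *m mul) + e).
have Hv : vder v t dv.
  have Hct : is_derive t 1 (fun s => c * s) c.
    apply: (der_ext _ _ _ _ _ (derM _ _ _ _ _ (der_cst c t) (is_derive_id t 1))) => //.
    by rewrite mul0r add0r mulr1.
  have := vderD _ _ _ _ _ _ (vderD _ _ _ _ _ _ vx (vder_cst _ (- xs) t))
    (vderZ _ _ _ _ _ _ Hct Hdx).
  congr vder.
  set q := - beta t *: (w + _) + e in dv *.
  have -> : ddx = q - (alpha / t) *: dx t.
    have wE : w + A^T *m mul = grad f (x t) + A^T *m lam t.
      by rewrite /w /mul mulmxBr addrAC addrA addrNK // addrAC addrK.
    by rewrite /q wE -eq1 addrK.
  rewrite /dv {dv}; clearbody q; apply/colP => i; rewrite !mxE.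
  have -> : alpha = c^-1 + 1 by rewrite invrK subrK.
  by field; rewrite !lt0r_neq0.
have Hmul : vder (fun s => lam s - lams) t dlam.
  by have := vderD _ _ _ _ _ _ Hlam (vder_cst _ (- lams) t); rewrite addr0.
have Hid : is_derive t (1 : R) (fun s : R => s) 1 by exact: is_derive_id.
have HE := derD _ _ _ _ _ (derD _ _ _ _ _
  (derM _ _ _ _ _ (der_cst (c * c) t)
    (derM _ _ _ _ _ (derM _ _ _ _ _ (derM _ _ _ _ _ Hid Hid) Hb) Hgap))
  (derM _ _ _ _ _ (der_dot _ _ _ _ _ _ Hv Hv) (der_cst 2^-1 t)))
  (derM _ _ _ _ _ (der_cst (c / 2) t) (der_dot _ _ _ _ _ _ Hmul Hmul)).
eexists; split; first exact: HE.
have Av : A *m (x t + (t / (alpha - 1)) *: dx t) - b = A *m v t.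
  by rewrite /v !mulmxDr mulmxN Ab [t / _]mulrC addrAC.
have dlamE : dot (lam t - lams) dlam = t * beta t * dot (v t) (A^T *m mul).
  by rewrite eq2 Av dotZr dot_mulmx dotC.
have dvE : dot (v t) dv =
    c * t * (- beta t * (dot (v t) w + dot (v t) (A^T *m mul)) + dot (v t) e).
  by rewrite /dv dotZr dotDr dotZr dotDr.
have vw : dot (v t) w = dot (x t - xs) w + c * t * dot w (dx t).
  by rewrite /v dotDl dotZl (dotC _ (dx t)).
(* The gradient inequality is now based at [x t] and tested at [xs], opposite to the one giving gap
   >= 0. *)
have Q : gap t <= dot (x t - xs) w.
  have := convex_grad f (x t) xs f_convex (f_diff _).
  rewrite -(opprB (x t)) dotNr /w dotDr [dot _ (A^T *m lams)]dotC -dot_mulmx.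
  by rewrite mulmxBr Ab (dotC _ _ (grad f (x t))) /gap; lra.
have ve := dot_le_enorm _ (v t) e.
have [_ Ev _] := energy_ge _ bt.
have gap0 := lagrangian_gap_ge0 t.
rewrite (dotC _ dv) (dotC _ dlam) dlamE dvE vw.
have e0 := enorm_ge0 _ e.
have ve' : dot (v t) e <= enorm e * (1 + energy t).
  apply: le_trans ve _; apply: ler_wpM2l => //; move: Ev (dot_ge0 _ (v t)); lra.
move: (gap t) (dot (x t - xs) w) (dot w (dx t)) (dot (v t) (A^T *m mul)) (dot (v t) e)
  (enorm e) (energy t) (beta t) bt db_le Q gap0 ve' e0 => g q W z ve1 ee En B B0 dbB Q g0 ve' _.
have ct : 0 <= c * t by rewrite mulr_ge0 // ltW.
(* The only use of the growth condition: 2 beta + t beta' <= (alpha - 1) beta. *)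
have cB : c * (2 * B + t * db) <= B.
  apply: (@le_trans _ _ (c * ((alpha - 1) * B))); last by rewrite mulrA cE mul1r.
  rewrite ler_wpM2l ?(ltW c0) //; lra.
have H1 : c * t * (c * (2 * B + t * db) * g) <= c * t * (B * q).
  rewrite ler_wpM2l //; apply: le_trans (ler_wpM2r g0 cB) _.
  by rewrite ler_wpM2l // ltW.
have H2 : c * t * ve1 <= c * t * (ee * (1 + En)) by rewrite ler_wpM2l.
lra.
Qed.
End lyapunov.

(** * The feasibility estimate for one coordinate *)

Lemma constraint_rate (R : realType) (a alpha M : R) (beta r l db dr dl : R -> R) :
  0 < a -> 1 < alpha ->
  (forall t, a <= t -> 0 < beta t) ->
  (forall t, a <= t -> is_derive t 1 beta (db t)) ->
  (forall t, a <= t -> is_derive t 1 r (dr t)) ->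
  (forall t, a <= t -> is_derive t 1 l (dl t)) ->
  (forall t, a <= t -> t * db t <= (alpha - 3) * beta t) ->
  (forall t, a <= t -> dl t = t * beta t * (r t + t / (alpha - 1) * dr t)) ->
  (forall t, a <= t -> `|l t| <= M) ->
  exists C, forall t, a <= t -> t * t * beta t * `|r t| <= C.
Proof.
move=> a0 alpha1 b0 Hb Hr Hl dbb dlE lM.
have M0 : 0 <= M by apply: le_trans (lM a _).
(* rho s = s^(alpha - 3) *)
pose rho s := expR ((alpha - 3) * ln s) : R.
have rho0 t : 0 < rho t by exact: expR_gt0.
have t_gt0 t : a <= t -> 0 < t by exact: lt_le_trans.
have Hrho t : a <= t -> is_derive t 1 rho (rho t * ((alpha - 3) * t^-1)).
  move=> at_.
  have H := derM _ _ _ _ _ (der_cst (alpha - 3) t) (is_derive1_ln (t_gt0 t at_)).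
  by have := is_derive1_comp (is_derive_expR _) H; rewrite mul0r add0r.
pose mu s := rho s * (beta s)^-1.
pose dmu s := rho s * ((alpha - 3) * beta s - s * db s) / (s * beta s ^+ 2).
have Hmu t : a <= t -> is_derive t 1 mu (dmu t).
  move=> at_; have bt := lt0r_neq0 (b0 t at_).
  apply: der_ext (derM _ _ _ _ _ (Hrho t at_) (is_deriveV bt (Hb t at_))) _ _ => //.
  rewrite /dmu /GRing.scale /=; field.
  by rewrite bt lt0r_neq0 // t_gt0.
have dmu0 t : a <= t -> 0 <= dmu t.
  move=> at_; rewrite /dmu divr_ge0 //.
    by rewrite mulr_ge0 ?(ltW (rho0 t)) // subr_ge0 dbb.
  by rewrite mulr_ge0 ?sqr_ge0 // ltW // t_gt0.
have mu0 t : a <= t -> 0 < mu t by move=> at_; rewrite /mu divr_gt0 // b0.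
have mu_ndecr t : a <= t -> mu a <= mu t.
  move=> at_; rewrite -subr_ge0; have dmu0' s : a <= s -> `|0 : R| <= dmu s.
    by move=> /dmu0; rewrite normr0.
  have := der_le_ndecr (fun=> 0) mu (fun=> 0) dmu a t at_ (fun s _ => der_cst 0 s) Hmu dmu0'.
  by rewrite subrr normr0.
(* The integration by parts in differential form: subtracting the boundary term (alpha-1) mu l
   removes [dr] and [dl] from the derivative, leaving only mu' l. *)
pose h s := s * s * rho s * r s + - (alpha - 1) * (mu s * l s).
have Hh t : a <= t -> is_derive t 1 h (- (alpha - 1) * (dmu t * l t)).
  move=> at_; have Hid : is_derive t (1 : R) (fun s : R => s) 1 by exact: is_derive_id.
  have bt := lt0r_neq0 (b0 t at_).
  apply: der_ext (derD _ _ _ _ _ (derM _ _ _ _ _ (derM _ _ _ _ _ (derM _ _ _ _ _ Hid Hid)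
     (Hrho t at_)) (Hr t at_)) (derM _ _ _ _ _ (der_cst (- (alpha - 1)) t)
     (derM _ _ _ _ _ (Hmu t at_) (Hl t at_)))) _ _ => //.
  rewrite (dlE t at_) /mu; field.
  by rewrite bt (lt0r_neq0 (t_gt0 t at_)) subr_eq0 gt_eqF.
have alpha_1 : 0 <= alpha - 1 by rewrite subr_ge0 ltW.
have h_le t : a <= t -> `|h t - h a| <= (alpha - 1) * M * mu t - (alpha - 1) * M * mu a.
  move=> at_; have HG s : a <= s -> is_derive s 1 (fun u => (alpha - 1) * M * mu u)
      (0 * mu s + (alpha - 1) * M * dmu s).
    by move=> as_; exact: (derM _ _ _ _ _ (der_cst _ _) (Hmu s as_)).
  apply: (der_le_ndecr h _ _ _ a t at_ Hh HG) => s as_.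
  rewrite mul0r add0r normrM normrN (ger0_norm alpha_1) -mulrA ler_wpM2l //.
  by rewrite normrM (ger0_norm (dmu0 s as_)) mulrC ler_wpM2r ?dmu0 // lM.
(* One (alpha-1) M bounds the increment of [h] and the other the boundary term, both relative to
   [mu t]; [h a] is absorbed through mu a <= mu t. *)
exists (`|h a| / mu a + 2 * ((alpha - 1) * M)) => t at_.
have mt := mu0 t at_; have ma := mu0 a (lexx a).
rewrite -(ler_pM2l mt).
have -> : mu t * (t * t * beta t * `|r t|) = `|t * t * rho t * r t|.
  have tt : 0 <= t * t by rewrite mulr_ge0 // ltW // t_gt0.
  rewrite normrM (ger0_norm (_ : 0 <= t * t * rho t)); last by rewrite mulr_ge0 // ltW.
  by rewrite /mu; field; rewrite lt0r_neq0 // b0.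
have -> : t * t * rho t * r t = (h t - h a) + h a + (alpha - 1) * (mu t * l t) by rewrite /h; ring.
apply: le_trans (ler_normD _ _) _.
have H1 := ler_normD (h t - h a) (h a).
have H2 : `|(alpha - 1) * (mu t * l t)| <= (alpha - 1) * (mu t * M).
  by rewrite normrM (ger0_norm alpha_1) ler_wpM2l // normrM (gtr0_norm mt) ler_wpM2l ?lM // ltW.
have H3 : `|h a| <= mu t * (`|h a| / mu a).
  rewrite mulrCA ler_peMr // ler_pdivlMr // mul1r; exact: mu_ndecr.
have H4 := mulr_ge0 (mulr_ge0 alpha_1 M0) (ltW ma).
have := h_le t at_; lra.
Qed.

(** * Continuity, measurability and Landau notation *)

Lemma within_coord (R : realType) (n : nat) (g : R -> 'cV[R]_n) (D B : set R) i :
  B `<=` D -> {within D, continuous g} -> {within B, continuous (fun s => g s i 0)}.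
Proof.
move=> BD cg; apply: (continuous_subspaceW BD) => s.
apply: (@continuous_comp (subspace D) _ _ g (fun N : 'cV[R]_n => N i 0)).
  exact: cg.
exact: coord_continuous.
Qed.

Lemma measurable_enorm d (T : measurableType d) (R : realType) (n : nat) (D : set T)
    (g : T -> 'cV[R]_n) : (forall i, measurable_fun D (fun t => g t i 0)) ->
  measurable_fun D (fun t => enorm (g t)).
Proof.
move=> mg; apply: (measurableT_comp (continuous_measurable_fun (@sqrt_continuous R))).
by apply: measurable_sum => i; exact: measurable_funX.
Qed.

Lemma eqO_pinfty (R : realType) (a C : R) (F G : R -> R) :
  (forall t, a <= t -> 0 < G t) -> (forall t, a <= t -> `|F t| * G t <= C) ->
  F =O_+oo (fun t => (G t)^-1).
Proof.
move=> G0 FG; apply/eqO_exP; exists (1 + `|C|).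
  by have := normr_ge0 C; lra.
apply: filterS (nbhs_pinfty_ge (num_real a)) => t at_.
have Gt := G0 t at_.
rewrite (gtr0_norm (_ : 0 < (G t)^-1)) ?invr_gt0 // ler_pdivlMr //.
by apply: le_trans (FG t at_) _; have := ler_norm C; lra.
Qed.

(** * Boundedness of the energy *)

Lemma energy_bounded (R : realType) (n m : nat) (f : 'cV[R]_n -> R)
    (A : 'M[R]_(m, n)) (b : 'cV[R]_m) (t0 alpha : R) (beta : R -> R)
    (eps : R -> 'cV[R]_n) (x : R -> 'cV[R]_n) (lam : R -> 'cV[R]_m)
    (xs : 'cV[R]_n) (lams : 'cV[R]_m) (a : R) :
  convex_function [set: 'cV[R]_n] f -> (forall z, differentiable f z) ->
  0 < t0 -> t0 < a -> 1 < alpha -> (forall t, t0 <= t -> 0 < beta t) ->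
  C1_from t0 beta ->
  (forall t, t0 <= t -> t * derive_from t0 beta t <= (alpha - 3) * beta t) ->
  (forall i, completed_lebesgue_measure.-integrable `[t0, +oo[
    (fun t => (eps t i 0)%:E)) ->
  (\int[completed_lebesgue_measure]_(t in `[t0, +oo[)
    (t * enorm (eps t))%:E < +oo)%E ->
  global_solution f A b t0 alpha beta eps x lam -> KKT_set f A b (xs, lams) ->
  exists K, forall t, a <= t ->
    energy f A b alpha beta x (derive_from t0 x) lam xs lams t <= K.
Proof.
move=> f_convex f_diff t0_gt0 t0a alpha_gt1 beta_gt0 beta_C1 beta_growth
  eps_int eps_moment [x_C1 lam_C1 dx_ac ode lamE] kkt.
set dx := derive_from t0 x in dx_ac ode lamE *.
pose g t := t * enorm (eps t).
have g0 t : t0 <= t -> 0 <= g t.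
  by move=> tt0; rewrite mulr_ge0 ?enorm_ge0 //; lra.
have mg : measurable_fun
   (`[t0, +oo[%classic : set (caratheodory_type ((wlength (@idfun R))^*)%mu)) g.
  apply: measurable_funM.
    move=> mD Y mY; apply: measurableI => //.
    exact: borel_completed_measurable.
  apply: measurable_enorm => i.
  by have /integrableP[/measurable_EFinP] := eps_int i.
have [G [Gndecr [GM GleM] HG]] := completed_primitive _ _ g0 mg eps_moment.
have Hx t : t0 < t -> is_derive t 1 x (dx t).
  by move=> tt0; apply: derivable_from_is_derive => //; apply: x_C1.1; exact: ltW.
have Hlam t : t0 < t -> is_derive t 1 lam (derive_from t0 lam t).
  by move=> tt0; apply: derivable_from_is_derive => //; apply: lam_C1.1; exact: ltW.
have Hbeta t : t0 < t -> is_derive t 1 beta (derive_from t0 beta t).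
  by move=> tt0; apply: derivable_from_is_derive => //; apply: beta_C1.1; exact: ltW.
have from_bnd k (u : R -> 'cV[R]_k) T i : a <= T ->
    {within `[t0, +oo[, continuous u} -> bnd a T (fun t => u t i 0).
  move=> aT cu; apply: within_bounded => //.
  apply: within_coord cu => t /=; rewrite !in_itv /= andbT => /andP[+ _].
  by apply: le_trans; exact: ltW.
(* Only [dx] needs the absolute continuity assumed of a solution; the other ingredients have bounded
   derivatives on [a, T]. *)
have E_bac T : a <= T -> ac_bnd a T (energy f A b alpha beta x dx lam xs lams).
  move=> aT.
  have lt0 t : a <= t -> t0 < t by exact: lt_le_trans.
  have x_bac : vac_bnd a T x.
    move=> i; apply: (@ac_bnd_C1 _ _ (fun t => dx t i 0)) => //.
      by move=> t at_; apply: is_derive_coord; exact: Hx (lt0 _ at_).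
    exact: from_bnd x_C1.2.
  have dx_bac : vac_bnd a T dx.
    move=> i; split; first exact: (loc_ac _ _ _ _ _ _ (ltW t0a) aT dx_ac).
    exact: from_bnd x_C1.2.
  have lam_bac : vac_bnd a T lam.
    move=> i; apply: (@ac_bnd_C1 _ _ (fun t => derive_from t0 lam t i 0)) => //.
      by move=> t at_; apply: is_derive_coord; exact: Hlam (lt0 _ at_).
    exact: from_bnd lam_C1.2.
  have beta_bac : ac_bnd a T beta.
    apply: (@ac_bnd_C1 _ _ (derive_from t0 beta)) => //.
      by move=> t at_; exact: Hbeta (lt0 _ at_).
    apply: within_bounded => //; apply: continuous_subspaceW beta_C1.2 => t /=.
    by rewrite !in_itv /= andbT => /andP[+ _]; apply: le_trans; exact: ltW.
  have f_bac : ac_bnd a T (fun t => f (x t)).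
    apply: (ac_bnd_convex_comp _ f x dx) => // [t at_|i]; first exact: Hx (lt0 _ at_).
    exact: from_bnd x_C1.2.
  have gap_bac := ac_bndD _ _ _ _ (ac_bndD _ _ _ _ f_bac (ac_bnd_cst a T (- f xs)))
    (ac_bnd_dot _ _ _ _ _ (vac_bnd_cst _ lams a T)
      (vac_bndD _ _ _ _ _ (vac_bndMl _ _ A _ _ _ x_bac) (vac_bnd_cst _ (- b) a T))).
  have v_bac := vac_bndD _ _ _ _ _ (vac_bndD _ _ _ _ _ x_bac (vac_bnd_cst _ (- xs) a T))
    (vac_bndZ _ _ _ _ _ (ac_bndM _ _ _ _ (ac_bnd_cst a T (alpha - 1)^-1) (ac_bnd_id a T)) dx_bac).
  have l_bac := vac_bndD _ _ _ _ _ lam_bac (vac_bnd_cst _ (- lams) a T).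
  exact: (ac_bndD _ _ _ _ (ac_bndD _ _ _ _
    (ac_bndM _ _ _ _ (ac_bnd_cst a T ((alpha - 1)^-1 * (alpha - 1)^-1))
      (ac_bndM _ _ _ _ (ac_bndM _ _ _ _ (ac_bndM _ _ _ _ (ac_bnd_id a T) (ac_bnd_id a T))
        beta_bac) gap_bac))
    (ac_bndM _ _ _ _ (ac_bnd_dot _ _ _ _ _ v_bac v_bac) (ac_bnd_cst a T 2^-1)))
    (ac_bndM _ _ _ _ (ac_bnd_cst a T ((alpha - 1)^-1 / 2)) (ac_bnd_dot _ _ _ _ _ l_bac l_bac))).
(* A single null set off which both the first equation and the derivative of [G] are available. *)
have [N [nN Nt]] : exists N, lebesgue_measure.-negligible N /\ forall t, ~ N t ->
    (t0 <= t -> derivable_from t0 dx t /\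
        derive_from t0 dx t + (alpha / t) *: dx t =
          - beta t *: (grad f (x t) + A^T *m lam t) + eps t) /\
    (t0 <= t -> is_derive t (1 : R) G (g t)).
  eexists; split; first exact: negligibleU ode HG.
  by move=> t /not_orP[/contrapT ? /contrapT ?].
set c := (alpha - 1)^-1.
have c0 : 0 < c by rewrite invr_gt0 subr_gt0.
set E := energy _ _ _ _ _ _ _ _ _ _ in E_bac *.
have E0 t : t0 <= t -> 0 <= E t.
  move=> tt0.
  have [_ + _] := energy_ge f A b alpha beta x dx lam xs lams alpha_gt1 f_convex
    f_diff kkt t (beta_gt0 t tt0).
  by apply: le_trans; rewrite divr_ge0 // dot_ge0.
(* [GM] bounds [G] everywhere, so the constant does not depend on [T]. *)
exists (expR (ln (1 + E a) + (c * GM - c * G a))) => T aT.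
have ET : 0 < 1 + E T by have := E0 T (le_trans (ltW t0a) aT); lra.
suff H : ln (1 + E T) - ln (1 + E a) <= c * G T - c * G a.
  have : 1 + E T <= expR (ln (1 + E a) + (c * GM - c * G a)).
    rewrite -{1}(lnK ET) ler_expR.
    have : c * G T <= c * GM by rewrite ler_wpM2l // ltW.
    by lra.
  by lra.
apply: (gronwall_ae R a T E (fun t => c * G t) (fun t => c * g t) N aT (E_bac T aT).1 _ _ nN).
- by move=> t at_ _; apply: E0; apply: le_trans at_; exact: ltW.
- by move=> u v uv; apply: (ler_wpM2l (ltW c0)); exact: Gndecr.
move=> t at_ tT /Nt[ode_t HGt].
have tt0 : t0 < t by exact: lt_le_trans at_.
have [dxt eq1] := ode_t (ltW tt0); have {}HGt := HGt (ltW tt0).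
split.
  by apply: der_ext (derM _ _ _ _ _ (der_cst c t) HGt) _ _ => //; rewrite mul0r add0r.
have t_gt0 := lt_trans t0_gt0 tt0.
apply: (energy_derive f A b alpha beta x dx lam xs lams alpha_gt1 f_convex f_diff kkt
  t (derive_from t0 dx t) (derive_from t0 lam t) (derive_from t0 beta t) (eps t)
  t_gt0 (beta_gt0 t (ltW tt0)) (Hx t tt0) _ _ (Hbeta t tt0)
  (beta_growth t (ltW tt0)) eq1 (lamE t (ltW tt0))).
- by move=> i; apply: is_derive_coord; exact: derivable_from_is_derive.
- by move=> i; apply: is_derive_coord; exact: Hlam.
Qed.

(** * The two rates *)

Theorem theorem2 (R : realType) (n m : nat) (f : 'cV[R]_n -> R)
    (A : 'M[R]_(m, n)) (b : 'cV[R]_m) (t0 alpha : R) (beta : R -> R)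
    (eps : R -> 'cV[R]_n) (x : R -> 'cV[R]_n) (lam : R -> 'cV[R]_m)
    (xs : 'cV[R]_n) (lams : 'cV[R]_m)
    (f_convex : convex_function [set: 'cV[R]_n] f)
    (f_diff : forall z, differentiable f z)
    (t0_gt0 : 0 < t0) (alpha_gt1 : 1 < alpha)
    (beta_gt0 : forall t, t0 <= t -> 0 < beta t)
    (beta_C1 : C1_from t0 beta)
    (beta_growth : forall t, t0 <= t ->
      t * derive_from t0 beta t <= (alpha - 3) * beta t)
    (beta_lim : t ^+ 2 * beta t @[t --> +oo] --> +oo)
    (eps_integrable : forall i,
      completed_lebesgue_measure.-integrable `[t0, +oo[
        (fun t => (eps t i 0)%:E))
    (eps_moment : (\int[completed_lebesgue_measure]_(t in `[t0, +oo[)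
      (t * enorm (eps t))%:E < +oo)%E)
    (sol : global_solution f A b t0 alpha beta eps x lam)
    (kkt : KKT_set f A b (xs, lams)) :
  (fun t => enorm (A *m x t - b)) =O_+oo (fun t => (t ^+ 2 * beta t)^-1) /\
  (fun t => `|f (x t) - f xs|) =O_+oo (fun t => (t ^+ 2 * beta t)^-1).
Proof.
have [x_C1 lam_C1 dx_ac ode lamE] := sol.
set dx := derive_from t0 x in dx_ac ode lamE *.
(* Any point beyond [t0] would do, the rates being asymptotic. *)
pose a := t0 + 1.
have t0a : t0 < a by rewrite ltrDl.
have lt0 t : a <= t -> t0 < t by exact: lt_le_trans.
have le0 t : a <= t -> t0 <= t by move=> /lt0/ltW.
have tpos t : a <= t -> 0 < t by move=> /lt0; exact: lt_trans.
have c0 : 0 < (alpha - 1)^-1 by rewrite invr_gt0 subr_gt0.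
have [K EK] := energy_bounded R n m f A b t0 alpha beta eps x lam xs lams a f_convex
  f_diff t0_gt0 t0a alpha_gt1 beta_gt0 beta_C1 beta_growth eps_integrable eps_moment sol kkt.
have Ege t : a <= t -> _ := fun at_ => energy_ge f A b alpha beta x dx lam xs lams alpha_gt1
  f_convex f_diff kkt t (beta_gt0 t (le0 t at_)).
pose r t := A *m x t - b.
(* The energy controls |lam - lams|^2; the inequality |y| <= 1 + y^2 turns this into a bound on each
   coordinate without square roots. *)
have lam_bnd t j : a <= t -> `|lam t j 0| <= `|lams j 0| + (1 + 2 * (alpha - 1) * K).
  move=> at_; have [_ _ H] := Ege t at_; have {}H := le_trans H (EK t at_).
  have H2 : dot (lam t - lams) (lam t - lams) <= 2 * (alpha - 1) * K.
    rewrite -(ler_pM2l (divr_gt0 c0 (ltr0Sn _ 1))); apply: le_trans H _.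
    by rewrite le_eqVlt; apply/orP; left; apply/eqP; field; rewrite subr_eq0 gt_eqF.
  have H3 : (lam t j 0 - lams j 0) ^+ 2 <= 2 * (alpha - 1) * K.
    apply: le_trans H2; rewrite dotE (bigD1 j) //= !mxE -expr2 lerDl.
    by apply: sumr_ge0 => i _; rewrite -expr2 sqr_ge0.
  rewrite -{1}(subrK (lams j 0) (lam t j 0)).
  apply: le_trans (ler_normD _ _) _; rewrite addrC lerD2l.
  have := sqr_ge0 (`|lam t j 0 - lams j 0| - 1); rewrite sqrrB1 real_normK ?num_real //.
  have := normr_ge0 (lam t j 0 - lams j 0); lra.
have r_rate j : exists C, forall t, a <= t -> t * t * beta t * `|r t j 0| <= C.
  apply: (@constraint_rate R a alpha (`|lams j 0| + (1 + 2 * (alpha - 1) * K)) beta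
    (fun t => r t j 0) (fun t => lam t j 0) (derive_from t0 beta)
    (fun t => (A *m dx t) j 0) (fun t => derive_from t0 lam t j 0)).
  - exact: tpos.
  - exact: alpha_gt1.
  - by move=> t /le0/beta_gt0.
  - move=> t at_; apply: derivable_from_is_derive; first exact: lt0.
    by apply: beta_C1.1; exact: le0.
  - move=> t at_.
    have vx : vder x t (dx t).
      move=> i; apply: is_derive_coord; apply: derivable_from_is_derive; first exact: lt0.
      by apply: x_C1.1; exact: le0.
    have := vderD _ _ _ _ _ _ (vderMl _ _ A _ _ _ vx) (vder_cst _ (- b) t).
    by rewrite addr0 => /(_ j).
  - move=> t at_; apply: is_derive_coord; apply: derivable_from_is_derive; first exact: lt0.
    by apply: lam_C1.1; exact: le0.
  - by move=> t /le0/beta_growth.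
  - move=> t at_; rewrite lamE ?le0 // /r mulmxDr -scalemxAr !mxE; ring.
  - by move=> t; exact: lam_bnd.
have [C HC] := choice r_rate.
have w0 t : a <= t -> 0 < t ^+ 2 * beta t.
  by move=> at_; rewrite mulr_gt0 ?beta_gt0 ?le0 // exprn_gt0 // tpos.
split.
  apply: (@eqO_pinfty R a (\sum_(j < m) C j)) => // t at_.
  rewrite ger0_norm ?enorm_ge0 //.
  apply: le_trans (ler_wpM2r (ltW (w0 t at_)) (enorm_le_sum _ _)) _.
  rewrite mulr_suml; apply: ler_sum => j _.
  by have := HC j t at_; rewrite mulrC expr2.
(* The first term comes from c^2 t^2 beta D <= K, the second from the feasibility constants applied
   to <lams, r>. *)
apply: (@eqO_pinfty R a (K * (alpha - 1) ^+ 2 + \sum_(j < m) `|lams j 0| * C j)) => // t at_.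
rewrite normr_id.
have gap0 := lagrangian_gap_ge0 f A b x xs lams f_convex f_diff kkt t.
have [H _ _] := Ege t at_; have {}H := le_trans H (EK t at_).
set D := f (x t) - f xs + dot lams (r t).
have DK : `|D| * (t ^+ 2 * beta t) <= K * (alpha - 1) ^+ 2.
  rewrite ger0_norm // -ler_pdivrMr; last by rewrite exprn_gt0 // subr_gt0.
  apply: le_trans H; rewrite le_eqVlt; apply/orP; left; apply/eqP.
  by rewrite /D /r; field; rewrite subr_eq0 gt_eqF.
have dotK : `|dot lams (r t)| * (t ^+ 2 * beta t) <= \sum_(j < m) `|lams j 0| * C j.
  rewrite dotE; apply: le_trans (ler_wpM2r (ltW (w0 t at_)) (ler_norm_sum _ _ _)) _.
  rewrite mulr_suml; apply: ler_sum => j _.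
  rewrite normrM -mulrA ler_wpM2l //.
  by have := HC j t at_; rewrite mulrC expr2.
have -> : f (x t) - f xs = D - dot lams (r t) by rewrite /D addrK.
apply: le_trans (ler_wpM2r (ltW (w0 t at_)) (ler_normB _ _)) _.
by rewrite mulrDl lerD.
Qed.
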